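(* Let $t\in[-1,0]$ and let $n\ge3$ be an integer. Let $$p=\frac{8n^2t^4(2n-1)-9n^2t^3(n-1)+(2nt^2-3t+4)(7n+1)}{2(1-t)\bigl(1+7n-2n^2t^3(2n-1)\bigr)}$$ and $$f(n,t)=\frac{p^2\,n(1-t)^2}{2(nt^2+1)}.$$ Then $$\alpha(n,t)\le\lfloor f(n,t)\rfloor\le\left\lfloor\frac{(16t-9)^2}{128t^2}\right\rfloor,$$ where for $t=0$ the last expression is read as $+\infty$.
   Context: $S^{n-1}$ is the unit sphere in $\mathbb R^n$. For $t\in[-1,1)$, a set $S\subseteq S^{n-1}$ is $t$-almost-equiangular if every $3$-element subset $\{x,y,z\}$ of $S$ satisfies $t\in\{x^{\mathsf T}y,x^{\mathsf T}z,y^{\mathsf T}z\}$. $\alpha(n,t)$ is the maximum cardinality of a $t$-almost-equiangular set in $S^{n-1}$. *)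

(* Defs.v *)
From mathcomp Require Import all_boot all_order all_algebra.
From mathcomp Require Import all_classical all_reals.

Set Implicit Arguments.
Unset Strict Implicit.
Unset Printing Implicit Defensive.

Import Order.TTheory GRing.Theory Num.Theory.

Local Open Scope classical_set_scope.
Local Open Scope card_scope.
Local Open Scope ring_scope.

Definition dotp (R : realType) (n : nat) (x y : 'cV[R]_n) : R :=
  (x^T *m y) ord0 ord0.

(* The library norm on 'cV[R]_n is the sup norm, so the Euclidean sphere is
   expressed through the inner product. *)
Definition unit_sphere (R : realType) (n : nat) : set 'cV[R]_n :=
  [set x | dotp x x = 1].

Definition almost_equiangular (R : realType) (n : nat) (t : R)
    (S : set 'cV[R]_n) : Prop :=
  S `<=` @unit_sphere R n /\
  forall x y z, S x -> S y -> S z -> x != y -> x != z -> y != z ->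
    t \in [:: dotp x y; dotp x z; dotp y z].

(* is_alpha n t a : the maximum cardinality exists and equals a.  S is an
   arbitrary, possibly infinite, set, so S #<= `I_a also says that S is
   finite. *)
Definition is_alpha (R : realType) (n : nat) (t : R) (a : nat) : Prop :=
  (exists2 S : set 'cV[R]_n, almost_equiangular t S & S #= `I_a) /\
  (forall S : set 'cV[R]_n, almost_equiangular t S -> S #<= `I_a).

Definition pnt (R : realType) (n : nat) (t : R) : R :=
  let N : R := n%:R in
  (8 * N ^+ 2 * t ^+ 4 * (2 * N - 1) - 9 * N ^+ 2 * t ^+ 3 * (N - 1)
     + (2 * N * t ^+ 2 - 3 * t + 4) * (7 * N + 1))
  / (2 * (1 - t) * (1 + 7 * N - 2 * N ^+ 2 * t ^+ 3 * (2 * N - 1))).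

Definition fnt (R : realType) (n : nat) (t : R) : R :=
  let N : R := n%:R in
  (pnt n t) ^+ 2 * N * (1 - t) ^+ 2 / (2 * (N * t ^+ 2 + 1)).

(* Main.v *)
Require Import Defs.
From mathcomp Require Import all_boot all_order all_algebra.
From mathcomp Require Import all_classical all_reals.
From mathcomp Require Import ring lra.

(** Put [u = - t], so [0 <= u <= 1].  Let [x_1, ..., x_N] be distinct points of
    a [t]-almost-equiangular set, [G] their Gram matrix, [J] the all-ones
    matrix, [e] the all-ones vector, and [A = G - t J - (1 - t) I].  The
    diagonal of [A] vanishes, and an off-diagonal entry of [A] vanishes exactly
    when the inner product is [t]; so the nonzero entries of [A] form a
    triangle-free graph, and [tr A = tr A^3 = 0].

    As [G] is positive semidefinite, [tr (G (A - b I)^2) >= 0] for every real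
    [b].  Substituting [G = A + (1 - t) I + t J] and using [tr A = tr A^3 = 0]
    leaves an inequality between [tr A^2] and the squared length of
    [(A - b I) e] ([main_trace]).  Cauchy-Schwarz bounds that length below by
    the entry sum of [A - b I], and, since [G] has trace [N] and rank at most
    [n], also gives [tr G^2 >= N^2 / n], which bounds [tr A^2] below.  What
    remains relates only [N], [n], [t] and the average row sum [X >= u N] of
    [G - t J] ([energy]).  It is used for two values of [b].  The value
    [b = 1 - t] gives, after a tangent-line estimate, an inequality on [N] for
    each slope [d >= 0] ([size_le_convex]); at [t = 0] this is Rosenfeld's
    argument for [N <= 2 n].  The value [b = (1 - t) / 2] makes [tr A^2]
    disappear and leaves a bound on [N] that does not depend on [n]
    ([size_le_const]).

    Comparing with [f] is calculus.  The key identity ([pntE]) is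
    [(1 - t) p = 2 (1 + u) - u (7 n + 1) (n u - 1)^2 / (2 D)] with
    [D = 7 n + 1 + 2 n^2 u^3 (2 n - 1)], which exhibits [p] as a perturbation
    of [2], with equality at [u = 0] and [u = 1 / n].  When [n u <= 1 / 2] the
    slope [d = 0] suffices ([fbound_small]).  When [n u >= 1 / 2] and
    [n u^2 <= (1 + 5 u) / 4], the optimal slope turns the claim into a
    polynomial inequality ([mid_discriminant], [fbound_mid]).  When
    [n u^2 >= (1 + 5 u) / 4], the bound independent of [n] suffices
    ([fbound_large]).

    The second inequality compares [f] with its limit for large [n]; writing
    [(1 - t) p = 9 / 8 + 2 u + excess], it says that the excess is small
    compared with [1 / (n u^2)] ([fbound_le_limit]).  For [n = 3]
    the two sides come within one part in a thousand of each other, and this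
    case is treated on its own.  Finally, the sizes of
    almost-equiangular sets being bounded by [f], a largest one exists. *)

Set Implicit Arguments.
Unset Strict Implicit.
Unset Printing Implicit Defensive.

Import Order.TTheory GRing.Theory Num.Theory.

Local Open Scope ring_scope.

(** * Trace inequalities for almost-equiangular families *)

Section Trace.
Variable F : realFieldType.

Lemma sqr_sum_le (N : nat) (x : 'I_N -> F) :
  (\sum_i x i) ^+ 2 <= N%:R * \sum_i x i ^+ 2.
Proof.
case: N x => [|N] x; first by rewrite !big_ord0 mulr0 expr0n.
set s := \sum_i x i.
have N0 : (0 : F) < N.+1%:R by rewrite ltr0n.
have : 0 <= \sum_i (x i - s / N.+1%:R) ^+ 2 by apply: sumr_ge0 => i _; exact: sqr_ge0.
have -> : \sum_i (x i - s / N.+1%:R) ^+ 2 = \sum_i x i ^+ 2 - s ^+ 2 / N.+1%:R.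
  rewrite (eq_bigr (fun i => x i ^+ 2 + (x i * (- 2 * s / N.+1%:R) + (s / N.+1%:R) ^+ 2)));
    last by move=> i _; ring.
  rewrite big_split big_split /= -mulr_suml -/s sumr_const card_ord -[X in _ + (_ + X)]mulr_natr.
  by move: N.+1%:R N0 => r r0; field; rewrite gt_eqF.
by rewrite subr_ge0 ler_pdivrMr// mulrC.
Qed.

Lemma mxtrace_sqr_sym m (X : 'M[F]_m) : X^T = X ->
  \tr (X *m X) = \sum_i \sum_j X i j ^+ 2.
Proof.
move=> Xs; rewrite /mxtrace; apply: eq_bigr => i _; rewrite mxE.
by apply: eq_bigr => j _; rewrite -{2}Xs mxE expr2.
Qed.

Lemma mxtrace_gram_ge0 m p (X : 'M[F]_(m, p)) : 0 <= \tr (X^T *m X).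
Proof.
apply: sumr_ge0 => i _; rewrite mxE; apply: sumr_ge0 => j _.
by rewrite mxE -expr2 sqr_ge0.
Qed.

Lemma mxtrace_const_mul m (X : 'M[F]_m) :
  \tr (const_mx 1 *m X) = \sum_i \sum_j X i j.
Proof.
rewrite exchange_big; apply: eq_bigr => i _ /=; rewrite mxE.
by apply: eq_bigr => j _; rewrite mxE mul1r.
Qed.

Lemma sum_delta N (i : 'I_N) (x : F) : \sum_j x *+ (i == j) = x.
Proof.
by rewrite (bigD1 i)//= big1 ?eqxx ?addr0// => j /negPf; rewrite eq_sym => ->.
Qed.

Lemma sqrmx_sub_scalar N (A : 'M[F]_N) b :
  (A - b%:M) *m (A - b%:M) = A *m A - (2 * b) *: A + (b ^+ 2)%:M.
Proof.
rewrite mulmxBl !mulmxBr mul_mx_scalar !mul_scalar_mx scale_scalar_mx.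
by rewrite expr2 mulr_natl mulr2n scalerDl opprB opprD !addrA [LHS]addrAC.
Qed.

Lemma mxtrace_mul_sqr N (A : 'M[F]_N) b :
  \tr (A *m ((A - b%:M) *m (A - b%:M))) =
  \tr (A *m (A *m A)) - 2 * b * \tr (A *m A) + b ^+ 2 * \tr A.
Proof.
rewrite sqrmx_sub_scalar mulmxDr mulmxBr -scalemxAr mul_mx_scalar.
by rewrite mxtraceD linearB /= !mxtraceZ.
Qed.

Lemma mxtrace_sqr_sub_scalar N (A : 'M[F]_N) b :
  \tr ((A - b%:M) *m (A - b%:M)) = \tr (A *m A) - 2 * b * \tr A + b ^+ 2 * N%:R.
Proof.
by rewrite sqrmx_sub_scalar mxtraceD linearB /= mxtraceZ mxtrace_scalar mulr_natr.
Qed.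

Section Gram.
(** The columns of [V] are the points, and [V^T *m V] is their Gram matrix. *)
Variables (n N : nat) (V : 'M[F]_(n, N)).
Local Notation G := (V^T *m V).

Lemma gram_sym : G^T = G.
Proof. by rewrite trmx_mul trmxK. Qed.

(** The Gram matrix and the [n]-by-[n] matrix [V *m V^T] have the same trace and
    the same Frobenius norm; on the [n] diagonal entries of the latter
    Cauchy-Schwarz brings in the dimension. *)
Lemma gram_frob : (\tr G) ^+ 2 <= n%:R * \sum_i \sum_j G i j ^+ 2.
Proof.
set W := V *m V^T.
have Ws : W^T = W by rewrite trmx_mul trmxK.
have -> : \sum_i \sum_j G i j ^+ 2 = \sum_i \sum_j W i j ^+ 2.
  rewrite -(mxtrace_sqr_sym gram_sym) -(mxtrace_sqr_sym Ws).
  by rewrite -mulmxA mxtrace_mulC !mulmxA.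
rewrite mxtrace_mulC; apply: le_trans (sqr_sum_le _) _.
apply: ler_wpM2l => //; apply: ler_sum => i _; rewrite (bigD1 i)//= lerDl.
by apply: sumr_ge0 => j _; exact: sqr_ge0.
Qed.

Lemma gram_sum_ge0 : 0 <= \sum_i \sum_j G i j.
Proof.
rewrite -mxtrace_const_mul.
have -> : const_mx 1 = const_mx 1 *m (const_mx 1 : 'M_(1, N)) :> 'M[F]_N.
  by apply/matrixP=> i j; rewrite !mxE big_ord1 !mxE mul1r.
rewrite -mulmxA mxtrace_mulC -!mulmxA mulmxA.
have -> : const_mx 1 *m V^T = (V *m const_mx 1)^T :> 'M[F]_(1, n).
  by rewrite trmx_mul trmx_const.
exact: mxtrace_gram_ge0.
Qed.

Variable t : F.
Hypothesis G1 : forall i, G i i = 1.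
Hypothesis Gt : forall i j k, i != j -> i != k -> j != k ->
  t \in [:: G i j; G i k; G j k].

Variable A : 'M[F]_N.
Hypothesis A_def : A = G - const_mx t - (1 - t)%:M.

Lemma A_sym : A^T = A.
Proof. by rewrite A_def !linearB /= gram_sym trmx_const tr_scalar_mx. Qed.

Lemma AE i j : A i j = G i j - t - (1 - t) *+ (i == j).
Proof. by rewrite A_def !mxE. Qed.

Lemma A_diag i : A i i = 0.
Proof. by rewrite AE G1 eqxx subrr. Qed.

Lemma A_tr : \tr A = 0.
Proof. by apply: big1 => i _; exact: A_diag. Qed.

Lemma A_offdiag i j : i != j -> (A i j == 0) = (G i j == t).
Proof. by move=> /negPf ij; rewrite AE ij subr0 subr_eq0. Qed.

(** A nonzero term of the expanded trace would be a triangle of pairs whose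
    inner products all differ from [t]. *)
Lemma A_tr3 : \tr (A *m (A *m A)) = 0.
Proof.
apply: big1 => i _; rewrite mxE; apply: big1 => j _; rewrite [(A *m A) j i]mxE mulr_sumr.
apply: big1 => k _; rewrite (_ : A k i = A i k); last by rewrite -[in LHS]A_sym [LHS]mxE.
have [<-|ij] := eqVneq i j; first by rewrite A_diag mul0r.
have [<-|ik] := eqVneq i k; first by rewrite A_diag !mulr0.
have [<-|jk] := eqVneq j k; first by rewrite A_diag mul0r mulr0.
have := Gt ij ik jk; rewrite !inE !(eq_sym t) -!A_offdiag//.
by case/or3P => /eqP ->; rewrite ?(mul0r,mulr0).
Qed.

Lemma A_tr2 : \tr (A *m A) = \sum_i \sum_j G i j ^+ 2
   - 2 * t * (\sum_i \sum_j G i j) + t ^+ 2 * N%:R ^+ 2 - (1 - t) ^+ 2 * N%:R.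
Proof.
rewrite (mxtrace_sqr_sym A_sym).
have E i j : A i j ^+ 2 = G i j ^+ 2 + (- 2 * t) * G i j + t ^+ 2 - ((1 - t) ^+ 2) *+ (i == j).
  rewrite AE; have [<-|_] := eqVneq i j; rewrite ?mulr1n ?mulr0n; last by ring.
  by rewrite G1; ring.
under eq_bigr => i _.
  under eq_bigr => j _ do rewrite E.
  rewrite !(sumrB, big_split)/= -mulr_sumr sumr_const card_ord.
  rewrite sum_delta.
  over.
rewrite !(sumrB, big_split)/= -mulr_sumr !sumr_const card_ord.
by ring.
Qed.

Lemma A_sum : \sum_i \sum_j A i j = \sum_i \sum_j G i j - t * N%:R ^+ 2 - (1 - t) * N%:R.
Proof.
under eq_bigr => i _.
  under eq_bigr => j _ do rewrite AE.
  rewrite !sumrB sumr_const card_ord.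
  rewrite sum_delta.
  over.
by rewrite !sumrB/= !sumr_const card_ord; ring.
Qed.

(** Expansion of [tr (G Z^2) >= 0] for [Z = A - b I].  As [t <= 0], the part
    [t J] of [G] contributes negatively, by the squared norm of the vector of
    row sums of [Z], and keeping this term is what improves on the bound
    [2 n + 2] that positivity of [G - t J] alone would give. *)
Lemma main_trace b : t <= 0 -> 
  - t * (\sum_i \sum_j A i j - b * N%:R) ^+ 2 <=
  N%:R * ((1 - t - 2 * b) * \tr (A *m A) + (1 - t) * b ^+ 2 * N%:R).
Proof.
move=> t0.
pose Z := A - b%:M.
have Zs : Z^T = Z by rewrite /Z linearB /= A_sym tr_scalar_mx.
have GE : G = A + (1 - t)%:M + t *: const_mx 1.
  by rewrite scalemx_const mulr1 A_def subrK subrK.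
have h : 0 <= \tr (G *m (Z *m Z)).
  have -> : \tr (G *m (Z *m Z)) = \tr ((V *m Z)^T *m (V *m Z)).
    by rewrite trmx_mul Zs mulmxA mxtrace_mulC !mulmxA.
  exact: mxtrace_gram_ge0.
have ZE k : \sum_j Z k j = \sum_j A k j - b.
  rewrite -[X in _ - X](sum_delta k) -sumrB; apply: eq_bigr => j _.
  by rewrite /Z [LHS]mxE [X in _ + X]mxE [(b%:M) k j]mxE.
have hJ : (\sum_i \sum_j A i j - b * N%:R) ^+ 2 <= N%:R * \tr (const_mx 1 *m (Z *m Z)).
  have -> : \tr (const_mx 1 *m (Z *m Z)) = \sum_k (\sum_j Z k j) ^+ 2.
    rewrite mxtrace_const_mul; under eq_bigr => i _.
      under eq_bigr => j _ do rewrite mxE.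
      rewrite exchange_big /=; under eq_bigr => k _ do rewrite -mulr_sumr.
      over.
    rewrite exchange_big /=; apply: eq_bigr => k _; rewrite -mulr_suml expr2.
    by congr (_ * _); apply: eq_bigr => i _; rewrite -{1}Zs mxE.
  have -> : \sum_i \sum_j A i j - b * N%:R = \sum_i \sum_j Z i j.
    under [RHS]eq_bigr => i _ do rewrite ZE.
    by rewrite sumrB sumr_const card_ord mulr_natr.
  exact: sqr_sum_le.
have trE : \tr (G *m (Z *m Z)) = (1 - t - 2 * b) * \tr (A *m A) + (1 - t) * b ^+ 2 * N%:R
    + t * \tr (const_mx 1 *m (Z *m Z)).
  rewrite {1}GE 2!mulmxDl -scalemxAl 2!mxtraceD mxtraceZ; congr (_ + _).
  rewrite mxtrace_mul_sqr mul_scalar_mx mxtraceZ mxtrace_sqr_sub_scalar.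
  rewrite A_tr A_tr3; ring.
rewrite trE in h; have := ler_wpM2l (ler0n F N) h.
have nt0 : 0 <= - t by rewrite oppr_ge0.
have := ler_wpM2l nt0 hJ; lra.
Qed.

(** [X] is the average row sum of [G - t J]; it is at least [- t N] because the
    entries of [G] have a nonnegative sum.  The parameter [b] of [main_trace] is
    taken as [(a - 1) (1 - t)]; for [a >= 3 / 2] the coefficient of [tr A^2] is
    nonpositive, so that its lower bound may be substituted. *)
Lemma energy : (0 < N)%N -> (0 < n)%N -> t <= 0 -> exists2 X, - t * N%:R <= X &
  forall a, 3 / 2 <= a ->
    - t * (X - a * (1 - t)) ^+ 2 +
    (2 * a - 3) * (1 - t) * (N%:R / n%:R - 2 * t * X - t ^+ 2 * N%:R)
      <= (a ^+ 2 - 2) * (1 - t) ^+ 3.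
Proof.
move=> N0 n0 t0; pose s := \sum_i \sum_j G i j.
have s0 : 0 <= s by exact: gram_sum_ge0.
have NR : (0 : F) < N%:R by rewrite ltr0n.
have nR : (0 : F) < n%:R by rewrite ltr0n.
exists (s / N%:R - t * N%:R); first by rewrite mulNr lerDr divr_ge0// ltW.
set X := (_ - t * N%:R) => a ha.
have sX : s = N%:R * X + t * N%:R ^+ 2.
  by rewrite /X mulrBr mulrCA divff ?mulr1 ?gt_eqF//; ring.
have := main_trace ((a - 1) * (1 - t)) t0.
rewrite A_sum A_tr2 -/s sX; set Q := \sum_i _ => H.
have Qn : N%:R ^+ 2 / n%:R <= Q.
  rewrite ler_pdivrMr// mulrC; apply: le_trans gram_frob.
  by rewrite /mxtrace (eq_bigr (fun=> 1)) ?sumr_const ?card_ord.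
have c0 : 0 <= (2 * a - 3) * (1 - t) by rewrite mulr_ge0//; lra.
have Qn' := ler_wpM2l c0 Qn.
have NR2 : 0 < N%:R ^+ 2 :> F by rewrite exprn_gt0.
rewrite -(ler_pM2l NR2).
have Qn'' := ler_wpM2l (ltW NR) Qn'.
lra.
Qed.


(** From [energy] at [a = 2], where the dependence on [X] is the square
    [(X - (1 - t))^2]; it is replaced by its tangent of slope [2 d (1 - t)],
    which is increasing in [X], and then [X] by its lower bound. *)
Lemma size_le_convex d : (0 < N)%N -> (0 < n)%N -> t <= 0 -> 0 <= d ->
  N%:R * (1 + (2 * d - 1) * (n%:R * t ^+ 2)) <=
  n%:R * (1 - t) * (2 + t - 2 * d * t - d ^+ 2 * t).
Proof.
move=> N0 n0 t0 d0.
have nR : (0 : F) < n%:R by rewrite ltr0n.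
have [X X0 H] := energy N0 n0 t0.
have /H {}H : (3 / 2 : F) <= 2 by lra.
have c0 : 0 < 1 - t by lra.
move: X0 H; set r := N%:R / n%:R => X0 H.
have rN : N%:R = n%:R * r by rewrite /r mulrC divfK// gt_eqF.
suff h : r + (2 * d - 1) * t ^+ 2 * N%:R <= (1 - t) * (2 + t - 2 * d * t - d ^+ 2 * t).
  have := ler_wpM2l (ltW nR) h; rewrite mulrDr -rN; lra.
rewrite -(ler_pM2l c0).
have nt0 : 0 <= - t by lra.
(* Nonnegativity of this square is the tangent inequality of slope [d]. *)
have := mulr_ge0 nt0 (sqr_ge0 (X - (1 - t) - d * (1 - t))).
have dX : 0 <= X + t * N%:R by lra.
have := mulr_ge0 (mulr_ge0 (mulr_ge0 d0 (ltW c0)) nt0) dX.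
lra.
Qed.

(** From [energy] at [a = 3 / 2], the value that removes the term with
    [1 / n].  The remaining bound [- t (2 X - 3 (1 - t))^2 <= (1 - t)^3] would
    give a square root; the tangent at [2 X = 5 (1 - t)] makes it rational,
    with little loss for [t] in between [-1] and [0]. *)
Lemma size_le_const : (0 < N)%N -> (0 < n)%N -> t <= 0 ->
  8 * t ^+ 2 * N%:R <= (1 - t) * (1 - 17 * t).
Proof.
move=> N0 n0 t0; have [X X0 H] := energy N0 n0 t0.
have /H {}H : (3 / 2 : F) <= 3 / 2 by lra.
have c0 : 0 < 1 - t by lra.
have nt0 : 0 <= - t by lra.
rewrite -(ler_pM2l c0).
have := mulr_ge0 nt0 (sqr_ge0 (2 * X - 5 * (1 - t))).
have dX : 0 <= X + t * N%:R by lra.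
have := mulr_ge0 (mulr_ge0 (ltW c0) nt0) dX.
lra.
Qed.

End Gram.

End Trace.

(** * Polynomial inequalities *)

(** A polynomial in [u] of degree [d] is nonnegative on [[a, b]] as soon as it
    is a nonnegative combination of the products
    [(u - a)^i (b - u)^(d - i)]; the factor [r ^+ k] serves polynomials with a
    second, nonnegative variable. *)
Lemma bernstein_ge0 (F : realFieldType) i j k (a b u r : F) :
  a <= u -> u <= b -> 0 <= r ->
  0 <= (u - a) ^+ i * (b - u) ^+ j * r ^+ k.
Proof. by move=> au ub r0; rewrite !mulr_ge0 ?exprn_ge0// subr_ge0. Qed.

(* Adds the products of total degree [i + j] in [u], with weight [r ^+ k]; the
   positive combination itself is left to linear arithmetic. *)
Ltac push_bernstein i j k hau hub hr :=
  have := bernstein_ge0 i j k hau hub hr;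
  lazymatch i with
  | O => idtac
  | S ?i' => push_bernstein i' (S j) k hau hub hr
  end.

Ltac bernstein F d hau hub := push_bernstein d O O hau hub (@ler01 F); lra.

Section Polynomials.
Variable F : realFieldType.
Implicit Types u s r m : F.

(** The cubic of the next lemma; it is concave for [u >= 0], and the interval
    allowed for [u] ends where [3 u^2 = (1 + 5 u) / 4], just below [113 / 200]. *)
Lemma mid_cubic_ge0 s u : 64^-1 <= u -> 3 * u ^+ 2 <= s ->
  s <= (1 + 5 * u) / 4 ->
  0 <= 7 * u - (1 + 5 * u) ^+ 3 / 32 - 3 / 2 * (1 + 5 * u) * u ^+ 2.
Proof.
move=> u1 s1 s2.
have u2 : u <= 113/200 by nra.
have h : 0 <= (u - 64^-1) * (113/200 - u) by apply: mulr_ge0; lra.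
nra.
Qed.

(** Away from [u = 0], the linear term of the quadratic form of
    [mid_discriminant] is dominated by its first square.  After division by
    [s (3 + 2 s)] the left-hand side is at most [2 s^3 + 6 s u^2], which
    increases with [s], and the right-hand side is at least [7 u]; so [s] may be
    replaced by [(1 + 5 u) / 4]. *)
Lemma mid_first_square s u : 64^-1 <= u -> 3 * u ^+ 2 <= s ->
  s <= (1 + 5 * u) / 4 ->
  2 * s ^+ 2 * (s ^+ 2 * (3 + 2 * s) + u ^+ 2 * (9 + 3 * s - s ^+ 2)) <=
   u * (7 * s + u ^+ 2) * (3 + 2 * s).
Proof.
move=> u1 s1 s2; have h := mid_cubic_ge0 u1 s1 s2.
have u0 : 0 <= u by lra.
have s0 : 0 <= s by nra.
set b := (1 + 5 * u) / 4 in s2.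
have h' : 2 * b ^+ 3 + 6 * b * u ^+ 2 <= 7 * u by rewrite /b; lra.
have b3 : s ^+ 3 <= b ^+ 3 by apply: lerXn2r; rewrite // nnegrE; lra.
have sb : s * u ^+ 2 <= b * u ^+ 2 by apply: ler_wpM2r; rewrite ?sqr_ge0.
have H : 2 * s ^+ 3 + 6 * s * u ^+ 2 <= 7 * u by lra.
have H2 : (2 * s ^+ 3 + 6 * s * u ^+ 2) * (s * (3 + 2 * s)) <=
    7 * u * (s * (3 + 2 * s)).
  by apply: ler_wpM2r => //; apply: mulr_ge0; lra.
have e1 : 0 <= u ^+ 3 * (3 + 2 * s) by rewrite mulr_ge0 ?exprn_ge0//; lra.
have e2 : 0 <= s ^+ 2 * u ^+ 2 * (9 * s) by rewrite !mulr_ge0 ?sqr_ge0//; lra.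
have e3 : 0 <= s ^+ 4 * u ^+ 2 by rewrite !mulr_ge0 ?exprn_ge0.
lra.
Qed.

(** Near [u = 0], the linear term of the same form is dominated by twice the
    product of the two square roots: [17 / 10] is a rational number below
    [sqrt 3]. *)
Lemma mid_both_squares s u : 0 < u -> u <= 64^-1 -> u / 2 <= s ->
  s <= (1 + 5 * u) / 4 ->
  s ^+ 2 * (3 + 2 * s) + u ^+ 2 * (9 + 3 * s - s ^+ 2) <=
  17 / 10 * (s - 5 * u ^+ 2).
Proof.
move=> u1 s1 s2 s3.
have s4 : s <= 69/256 by lra.
have s0 : 0 < s by lra.
have a1 : u ^+ 2 <= s / 32 by nra.
have a2 : s ^+ 2 <= s * (69/256) by nra.
have a3 : 0 <= u ^+ 2 by exact: sqr_ge0.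
have a4 : s ^+ 3 <= s * (69/256) ^+ 2 by nra.
nra.
Qed.

(** With [s = n u^2], the cubic [7 s u + u^3 + 4 s^3 - 2 s^2 u^2] is
    [u^3 fden n u], and the factor after [9/2 + 8 u] is [u^3] times the
    numerator of [excess n u]. *)
Definition large_poly s u :=
  s * (65/16 - u ^+ 2) * (7*s*u + u ^+ 3 + 4*s ^+ 3 - 2*s ^+ 2*u ^+ 2)
  + s * (9/2 + 8 * u)
    * (u*s ^+ 2*(14 - 9/2*u) + 2*s*u ^+ 3 + (7*s*u + u ^+ 3)*(7/4 - u))
  - (17 * u ^+ 2 + 18 * u + 1)
    * (7*s*u + u ^+ 3 + 4*s ^+ 3 - 2*s ^+ 2*u ^+ 2).

Lemma large_poly_low u r : 0 <= u -> u <= 3/5 -> 0 <= r ->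
  0 <= large_poly ((1 + 5 * u) / 4 + r) u.
Proof.
move=> u0 u1 r0; rewrite /large_poly.
push_bernstein 7%N 0%N 0%N u0 u1 r0.
push_bernstein 6%N 0%N 1%N u0 u1 r0.
push_bernstein 5%N 0%N 2%N u0 u1 r0.
push_bernstein 4%N 0%N 3%N u0 u1 r0.
push_bernstein 2%N 0%N 4%N u0 u1 r0.
lra.
Qed.

Lemma large_poly_high u r : 3/5 <= u -> u <= 1 -> 0 <= r ->
  0 <= large_poly (3 * u ^+ 2 + r) u.
Proof.
move=> u0 u1 r0; rewrite /large_poly.
push_bernstein 10%N 0%N 0%N u0 u1 r0.
push_bernstein 8%N 0%N 1%N u0 u1 r0.
push_bernstein 6%N 0%N 2%N u0 u1 r0.
push_bernstein 4%N 0%N 3%N u0 u1 r0.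
push_bernstein 2%N 0%N 4%N u0 u1 r0.
lra.
Qed.

(** Of the two lower bounds on [s], the first is the larger one for small [u]
    and the second, which expresses [n >= 3], for large [u].  Expanded around
    the first one up to [u = 3/5] and around the second one beyond, the
    polynomial has nonnegative coefficients. *)
Lemma large_poly_ge0 s u : 0 <= u -> u <= 1 ->
  (1 + 5 * u) / 4 <= s -> 3 * u ^+ 2 <= s -> 0 <= large_poly s u.
Proof.
move=> u0 u1 s1 s2; have [h|/ltW h] := leP u (3/5).
  rewrite -[s](subrK ((1 + 5 * u) / 4)) addrC.
  by apply: large_poly_low; rewrite // subr_ge0.
rewrite -[s](subrK (3 * u ^+ 2)) addrC.
by apply: large_poly_high; rewrite // subr_ge0.
Qed.

(** The coefficients, in powers of [m = n - 4], of the polynomial whose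
    nonnegativity is [excess_poly_ge4]; the last two carry further factors
    [u^2] and [u^3]. *)
Definition coef0 u : F :=
  319/4 + 261*u - 1044*u ^+ 2 + 1544*u ^+ 3 - 1920*u ^+ 4 + 1152*u ^+ 5.
Definition coef1 u : F :=
  77/4 + 63*u - 513*u ^+ 2 + 1056*u ^+ 3 - 1344*u ^+ 4 + 864*u ^+ 5.
Definition coef2 u : F := -63 + 479/2*u - 312*u ^+ 2 + 216*u ^+ 3.
Definition coef3 u : F := 18 - 24*u + 18*u ^+ 2.

(** Negativity of [k2], absorbed by the cubic term: [(u m - e)^2 >= 0]. *)
Lemma cubic_ge0_via_cube u m e k0 k1 k2 k3 : 0 <= u -> 0 <= m ->
  0 <= k0 -> 0 <= k1 - e ^+ 2 * u * k3 -> 0 <= k2 + 2 * e * k3 -> 0 <= k3 ->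
  0 <= k0 + k1 * m + u ^+ 2 * k2 * m ^+ 2 + u ^+ 3 * k3 * m ^+ 3.
Proof.
move=> u0 m0 h0 h1 h2 h3.
have -> : k0 + k1 * m + u ^+ 2 * k2 * m ^+ 2 + u ^+ 3 * k3 * m ^+ 3 =
  k0 + m * (k1 - e ^+ 2 * u * k3)
  + u ^+ 2 * m ^+ 2 * (k2 + 2 * e * k3) + u * m * k3 * (u * m - e) ^+ 2 by ring.
have a1 := mulr_ge0 m0 h1.
have a2 := mulr_ge0 (mulr_ge0 (exprn_ge0 2 u0) (exprn_ge0 2 m0)) h2.
have a3 := mulr_ge0 (mulr_ge0 (mulr_ge0 u0 m0) h3) (sqr_ge0 (u * m - e)).
exact: addr_ge0 (addr_ge0 (addr_ge0 h0 a1) a2) a3.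
Qed.

(** Negativity of [k1], absorbed by the quadratic term: [(m - e)^2 >= 0]. *)
Lemma cubic_ge0_via_square u m e k0 k1 k2 k3 : 0 <= u -> 0 <= m ->
  0 <= k0 - e ^+ 2 * u ^+ 2 * k2 -> 0 <= k1 + 2 * e * u ^+ 2 * k2 ->
  0 <= k2 -> 0 <= k3 ->
  0 <= k0 + k1 * m + u ^+ 2 * k2 * m ^+ 2 + u ^+ 3 * k3 * m ^+ 3.
Proof.
move=> u0 m0 h0 h1 h2 h3.
have -> : k0 + k1 * m + u ^+ 2 * k2 * m ^+ 2 + u ^+ 3 * k3 * m ^+ 3 =
  (k0 - e ^+ 2 * u ^+ 2 * k2) + (k1 + 2 * e * u ^+ 2 * k2) * m
  + (u ^+ 2 * k2 * (m - e) ^+ 2 + u ^+ 3 * k3 * m ^+ 3) by ring.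
have a1 := mulr_ge0 (mulr_ge0 (exprn_ge0 2 u0) h2) (sqr_ge0 (m - e)).
have a2 := mulr_ge0 (mulr_ge0 (exprn_ge0 3 u0) h3) (exprn_ge0 3 m0).
exact: addr_ge0 (addr_ge0 h0 (mulr_ge0 h1 m0)) (addr_ge0 a1 a2).
Qed.

(** At most one of [coef1] and [coef2] is markedly negative, depending on [u];
    the tangent point [e] is chosen on each interval accordingly. *)
Lemma coef_cubic_ge0 u m : 0 <= u -> u <= 1 -> 0 <= m ->
  0 <= coef0 u + coef1 u * m + u ^+ 2 * coef2 u * m ^+ 2
       + u ^+ 3 * coef3 u * m ^+ 3.
Proof.
move=> u0 u1 m0.
have h3 : 0 <= coef3 u by rewrite /coef3; nra.
have [ub|/ltW ua] := leP u (1/5).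
  by apply: (@cubic_ge0_via_cube _ _ 2) => //; rewrite /coef0 /coef1 /coef2 /coef3;
    bernstein F 5%N u0 ub.
have [ub|/ltW {}ua] := leP u (3/8).
  by apply: (@cubic_ge0_via_cube _ _ 1) => //; rewrite /coef0 /coef1 /coef2 /coef3;
    bernstein F 5%N ua ub.
have [ub|/ltW {}ua] := leP u (1/2).
  (* Here both signs change, but constant bounds on the coefficients suffice. *)
  have b0 : 58 <= coef0 u by rewrite /coef0; bernstein F 5%N ua ub.
  have b1 : -(5/2) <= coef1 u by rewrite /coef1; bernstein F 5%N ua ub.
  have b2 : -(4/5) <= u ^+ 2 * coef2 u by rewrite /coef2; bernstein F 5%N ua ub.
  have b3 : 3/5 <= u ^+ 3 * coef3 u by rewrite /coef3; bernstein F 5%N ua ub.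
  have := ler_wpM2r m0 b1.
  have := ler_wpM2r (sqr_ge0 m) b2.
  have := ler_wpM2r (exprn_ge0 3 m0) b3.
  have : 0 <= m * (m - 2) ^+ 2 by rewrite mulr_ge0 ?sqr_ge0.
  nra.
have [ub|/ltW {}ua] := leP u (13/20).
  by apply: (@cubic_ge0_via_square _ _ 1) => //; rewrite /coef0 /coef1 /coef2;
    bernstein F 5%N ua ub.
have [ub|/ltW {}ua] := leP u (3/4).
  by apply: (@cubic_ge0_via_square _ _ (1/2)) => //; rewrite /coef0 /coef1 /coef2;
    bernstein F 5%N ua ub.
have [ub|/ltW {}ua] := leP u (7/8).
  by apply: (@cubic_ge0_via_square _ _ 0) => //; rewrite /coef0 /coef1 /coef2;
    bernstein F 5%N ua ub.
by apply: (@cubic_ge0_via_square _ _ 0) => //; rewrite /coef0 /coef1 /coef2;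
  bernstein F 5%N ua u1.
Qed.

End Polynomials.

(** * The function f *)

Section Bound.
Variable F : realFieldType.
Variables n u : F.
Implicit Types N d : F.

Definition fden : F := 7 * n + 1 + 2 * n ^+ 2 * u ^+ 3 * (2 * n - 1).
Definition rho : F := (7 * n + 1) * (n * u - 1) ^+ 2 / (2 * fden).

(** This is [(1 - t) p] for [u = - t]; see [pntE]. *)
Definition fnum : F := 2 * (1 + u) - u * rho.
Definition fbound : F := fnum ^+ 2 * n / (2 * (n * u ^+ 2 + 1)).

(** What [fnum] exceeds its limit for large [n] by; see [fnumE]. *)
Definition excess : F :=
  (n ^+ 2 * u ^+ 2 * (14 - 9/2*u) + 2*n*u ^+ 2 + (7*n + 1) * (7/4 - u))
  / (2 * fden).

Hypotheses (n3 : 3 <= n) (u0 : 0 <= u) (u1 : u <= 1).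

Lemma fden_ge : 7 * n + 1 <= fden.
Proof.
by move: n3 u0 => hn hu; rewrite /fden lerDl !mulr_ge0 ?exprn_ge0 //; lra.
Qed.

Lemma fden_gt0 : 0 < fden.
Proof. by move: n3 fden_ge => hn h; lra. Qed.

Lemma rhoE : rho * (2 * fden) = (7 * n + 1) * (n * u - 1) ^+ 2.
Proof. by rewrite /rho divfK// gt_eqF// mulr_gt0// fden_gt0. Qed.

Lemma rho_ge0 : 0 <= rho.
Proof.
move: n3 fden_gt0 => hn D; apply: divr_ge0; last by lra.
by rewrite mulr_ge0 ?sqr_ge0//; lra.
Qed.

Lemma excessE : excess * (2 * fden) =
  n ^+ 2 * u ^+ 2 * (14 - 9/2*u) + 2*n*u ^+ 2 + (7*n + 1) * (7/4 - u).
Proof. by rewrite /excess divfK// gt_eqF// mulr_gt0// fden_gt0. Qed.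

Lemma excess_ge0 : 0 <= excess.
Proof.
move: n3 u0 u1 fden_gt0 => hn hu hu1 D; apply: divr_ge0; last by lra.
by rewrite !addr_ge0 ?mulr_ge0 ?sqr_ge0//; lra.
Qed.

Lemma fnumE : fnum = 9 / 8 + 2 * u + excess.
Proof.
move: fden_gt0; rewrite /fnum /rho /excess /fden => D.
by field; apply: lt0r_neq0; lra.
Qed.

Lemma le_fbound N : N * (2 * (n * u ^+ 2 + 1)) <= fnum ^+ 2 * n -> N <= fbound.
Proof.
move: n3 => hn; have h : 0 <= n * u ^+ 2 by rewrite mulr_ge0 ?sqr_ge0//; lra.
by rewrite /fbound ler_pdivlMr//; lra.
Qed.

(** For [n u <= 1 / 2] one has [rho <= 1 / 2], hence
    [fnum^2 >= 2 (1 + u) (2 + u)], and it remains that [2 n u^2 <= u]. *)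
Lemma fbound_small N : n * u <= 1 / 2 ->
  N * (1 - n * u ^+ 2) <= n * (1 + u) * (2 - u) -> N <= fbound.
Proof.
move: n3 u0 u1 => hn hu hu1 x1 HN; apply: le_fbound => //.
have nu0 : 0 <= n * u by rewrite mulr_ge0//; lra.
have rho1 : rho <= 1 / 2.
  have D := fden_gt0; have D' := fden_ge.
  rewrite /rho ler_pdivrMr; last by lra.
  have : (n * u - 1) ^+ 2 <= 1 by nra.
  nra.
have rh := rho_ge0.
have P1 : 2 * (1 + u) - u / 2 <= fnum by rewrite /fnum; nra.
have P2 : 2 * (1 + u) * (2 + u) <= fnum ^+ 2 by nra.
have s1 : n * u ^+ 2 <= u / 2 by nra.
set s := n * u ^+ 2 in HN s1 *.
have s0 : 0 <= s by rewrite mulr_ge0 ?sqr_ge0//; lra.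
have s2 : 0 < 1 - s by lra.
rewrite -(ler_pM2r s2).
have h1 : N * (1 - s) * (2 * (s + 1)) <= n * (1 + u) * (2 - u) * (2 * (s + 1)).
  by apply: ler_wpM2r => //; lra.
have h2 : 2 * (1 + u) * (2 + u) * (n * (1 - s)) <= fnum ^+ 2 * (n * (1 - s)).
  by apply: ler_wpM2r => //; apply: mulr_ge0; lra.
have h3 : 0 <= n * (1 + u) * (u / 2 - s).
  by apply: mulr_ge0; [apply: mulr_ge0|]; lra.
lra.
Qed.

(** Here [4 fnum^2] is bounded below by its part linear in the excess, and
    multiplying the claim by [u^3 fden] turns it into [large_poly_ge0]. *)
Lemma fbound_large N : (1 + 5 * u) / 4 <= n * u ^+ 2 ->
  8 * u ^+ 2 * N <= (1 + u) * (17 * u + 1) -> N <= fbound.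
Proof.
move: n3 u0 u1 => hn hu hu1 hs HN; apply: le_fbound => //.
have u_gt0 : 0 < u.
  by rewrite lt_neqAle u0 andbT; apply/eqP => t00; move: hs; rewrite -t00; lra.
have D := fden_gt0; have e0 := excess_ge0; have eE := excessE.
have P2 : (9/4 + 4*u) ^+ 2 + excess * (9 + 16 * u) <= 4 * fnum ^+ 2.
  by have := sqr_ge0 excess; rewrite fnumE; lra.
set s := n * u ^+ 2 in hs *.
have s3 : 3 * u ^+ 2 <= s by rewrite /s; apply: ler_wpM2r; rewrite ?sqr_ge0.
have := large_poly_ge0 u0 u1 hs s3; rewrite /large_poly.
have -> : 7*s*u + u ^+ 3 + 4*s ^+ 3 - 2*s ^+ 2*u ^+ 2 = u ^+ 3 * fden.
  by rewrite /fden /s; ring.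
have -> : u*s ^+ 2*(14 - 9/2*u) + 2*s*u ^+ 3 + (7*s*u + u ^+ 3)*(7/4 - u) =
    u ^+ 3 * (excess * (2 * fden)) by rewrite eE /s; ring.
move=> h.
have h2 : u ^+ 3 * fden * (17 * u ^+ 2 + 18 * u + 1) <=
  u ^+ 3 * fden * (s * (65/16 - u ^+ 2) + s * excess * (9 + 16 * u)) by lra.
rewrite ler_pM2l in h2; last by rewrite mulr_gt0 ?exprn_gt0.
have s0 : 0 < s by lra.
have h3 := ler_wpM2l (ltW s0) P2.
have uu : 0 < u ^+ 2 by rewrite exprn_gt0.
have K0 : 0 <= s + 1 by lra.
have h4 := ler_wpM2r K0 HN.
rewrite -(ler_pM2r uu).
have : fnum ^+ 2 * n * u ^+ 2 = s * fnum ^+ 2 by rewrite /s; ring.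
lra.
Qed.

(** The difference of the two sides is the quadratic form
    [M^2 (3 + 2 s) - 2 B (M h) + ((n - 5) h)^2] in [M = 7 n + 1] and
    [h = n^2 u^3], where [B = (2 n - 1) (1 + s)^2 - (n - 5) (2 + s)].  The upper
    bound on [s] makes it nonnegative: for small [u] because
    [B <= sqrt 3 (n - 5)], otherwise because [h] is small compared with [M]. *)
Lemma mid_discriminant (s := n * u ^+ 2) :
  0 < u -> u / 2 <= s -> s <= (1 + 5 * u) / 4 ->
  (1 + s) ^+ 2 * (7 * n + 1) * fden <=
  (2 * fden - (n * u - 1) * s * (7 * n + 1)) ^+ 2.
Proof.
move: n3 u0 u1 => hn hu hu1 u_gt0 s_x hs.
have s3 : 3 * u ^+ 2 <= s by rewrite /s; apply: ler_wpM2r; rewrite ?sqr_ge0.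
pose M := 7 * n + 1; pose h := n ^+ 2 * u ^+ 3.
pose B := (2 * n - 1) * (1 + s) ^+ 2 - (n - 5) * (2 + s).
have h0 : 0 <= h by rewrite mulr_ge0 ?exprn_ge0//; lra.
have M0 : 0 < M by rewrite /M; lra.
have BE : s ^+ 2 * (3 + 2 * s) + u ^+ 2 * (9 + 3 * s - s ^+ 2) = u ^+ 2 * B.
  by rewrite /B /s; ring.
rewrite -subr_ge0.
have -> : (2 * fden - (n * u - 1) * s * (7 * n + 1)) ^+ 2
    - (1 + s) ^+ 2 * (7 * n + 1) * fden =
    M ^+ 2 * (3 + 2 * s) - 2 * M * h * B + ((n - 5) * h) ^+ 2.
  by rewrite /B /fden /M /h /s; ring.
have [u64|/ltW u64] := leP u 64^-1.
  have := mid_both_squares u_gt0 u64 s_x hs; rewrite BE.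
  have -> : s - 5 * u ^+ 2 = u ^+ 2 * (n - 5) by rewrite /s; ring.
  rewrite mulrCA ler_pM2l ?exprn_gt0// => hB.
  have := ler_wpM2l (mulr_ge0 (ltW M0) h0) hB.
  have := sqr_ge0 (17 / 10 * M - (n - 5) * h).
  have : 0 <= M ^+ 2 * s by rewrite mulr_ge0 ?sqr_ge0//; lra.
  have := sqr_ge0 M; lra.
have := mid_first_square u64 s3 hs; rewrite BE.
have -> : 7 * s + u ^+ 2 = u ^+ 2 * M by rewrite /M /s; ring.
have -> : 2 * s ^+ 2 * (u ^+ 2 * B) = u ^+ 3 * (2 * h * B).
  by rewrite /h /s; ring.
have -> : u * (u ^+ 2 * M) * (3 + 2 * s) = u ^+ 3 * (M * (3 + 2 * s)) by ring.
rewrite ler_pM2l ?exprn_gt0// => hB.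
have := ler_wpM2l (ltW M0) hB.
have := sqr_ge0 ((n - 5) * h); lra.
Qed.

(** Write [s = n u^2], [K = 1 + s] and [v = n u - 1].  With [d = 1 + g] and
    [fnum^2 >= 4 (1 + u)^2 - 4 (1 + u) u rho], the claim becomes
    [4 g (v - rho s) - K g^2 - 2 rho K >= 0]; the best choice
    [g = 2 (v - rho s) / K] leaves [2 (v - rho s)^2 >= rho K^2], which is
    [mid_discriminant] multiplied by a square. *)
Lemma fbound_mid N : 1 / 2 <= n * u -> n * u ^+ 2 <= (1 + 5 * u) / 4 ->
  (forall d, 0 <= d -> N * (1 + (2 * d - 1) * (n * u ^+ 2)) <=
     n * (1 + u) * (2 - u + 2 * d * u + d ^+ 2 * u)) -> N <= fbound.
Proof.
move: n3 u0 u1 => hn hu hu1 x1 hs HN; apply: le_fbound => //.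
have u_gt0 : 0 < u.
  by rewrite lt_neqAle u0 andbT; apply/eqP => t00; move: x1; rewrite -t00; lra.
have s_x : u / 2 <= n * u ^+ 2 by nra.
have key := mid_discriminant u_gt0 s_x hs.
have D := fden_gt0; have D' := fden_ge; have R := rhoE.
set s := n * u ^+ 2 in hs HN s_x key *.
have s3 : 3 * u ^+ 2 <= s by rewrite /s; apply: ler_wpM2r; rewrite ?sqr_ge0.
have s1 : s <= 1 by nra.
pose v := n * u - 1; pose M := 7 * n + 1; pose K := 1 + s.
pose b := 2 * fden - v * s * M.
rewrite -/v -/M -/K -/b in key R.
have b0 : 0 <= b.
  pose h := n ^+ 2 * u ^+ 3.
  have h0 : 0 <= h by rewrite mulr_ge0 ?exprn_ge0//; lra.
  have a1 : 0 <= h * (n - 3) by rewrite mulr_ge0//; lra.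
  have a2 : h <= n * s.
    have -> : h = n * s * u by rewrite /h /s; ring.
    by rewrite ler_piMr// mulr_ge0//; lra.
  have a3 : 0 <= s * (n + 1) by rewrite mulr_ge0//; lra.
  have -> : b = M * (2 + s) + h * (n - 5).
    by rewrite /b /M /h /v /fden /s; ring.
  by rewrite /M; lra.
pose g := 2 * (v - rho * s) / K.
have K0 : 0 < K by rewrite /K; lra.
have gK : g * K = 2 * (v - rho * s) by rewrite divfK// gt_eqF.
have gb : g * K * fden = v * b.
  have -> : v * b = 2 * v * fden - s * (M * v ^+ 2) by rewrite /b; ring.
  by rewrite gK -R; ring.
have d0 : 0 <= 1 + g.
  have [v0|v0] := leP 0 v.
    have : 0 <= g * K * fden by rewrite gb mulr_ge0.
    by rewrite pmulr_lge0// pmulr_lge0//; lra.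
  have : 0 <= (1 + g) * K * fden.
    rewrite mulrDl mul1r mulrDl gb /b.
    have v1 : v ^+ 2 <= 1.
      have v2 : 0 <= 1 + v by rewrite /v; lra.
      have v3 : 0 <= - v by lra.
      have := mulr_ge0 v2 v3; lra.
    have a1 : v ^+ 2 * (s * M) <= 1 * (s * M).
      by apply: ler_wpM2r => //; apply: mulr_ge0; rewrite /M; lra.
    have a2 : s * M <= s * fden by apply: ler_wpM2l => //; lra.
    have a3 : 0 <= (2 * n * u - 1) * fden by apply: mulr_ge0; lra.
    by rewrite /K; move: a1 a2 a3; rewrite /v; lra.
  by rewrite pmulr_lge0// pmulr_lge0.
have hN := HN _ d0.
have gs : 0 < K + 2 * g * s by rewrite /K; nra.
have q : 2 * rho * K ^+ 2 <= 4 * (v - rho * s) ^+ 2.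
  have D2 : 0 < fden ^+ 2 by rewrite exprn_gt0.
  rewrite -(ler_pM2r D2).
  have -> : 4 * (v - rho * s) ^+ 2 * fden ^+ 2 = v ^+ 2 * b ^+ 2.
    by rewrite -[RHS]exprMn -gb gK; ring.
  have -> : 2 * rho * K ^+ 2 * fden ^+ 2 = v ^+ 2 * (K ^+ 2 * M * fden).
    have -> : 2 * rho * K ^+ 2 * fden ^+ 2 =
      rho * (2 * fden) * (K ^+ 2 * fden) by ring.
    by rewrite R; ring.
  by apply: ler_wpM2l; rewrite ?sqr_ge0.
have P2 : 4 * (1 + u) ^+ 2 - 4 * (1 + u) * (u * rho) <= fnum ^+ 2.
  by rewrite /fnum; have := sqr_ge0 (u * rho); lra.
have q2 : 0 <= 4 * g * (v - rho * s) - K * g ^+ 2 - 2 * rho * K.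
  rewrite -(pmulr_lge0 _ K0).
  have -> : (4 * g * (v - rho * s) - K * g ^+ 2 - 2 * rho * K) * K =
    4 * (g * K) * (v - rho * s) - (g * K) ^+ 2 - 2 * rho * K ^+ 2 by ring.
  by rewrite gK; lra.
rewrite -(ler_pM2r gs).
have h1 := ler_wpM2r (ltW K0) hN.
have n0 : 0 <= n by lra.
have h2 := ler_wpM2l (mulr_ge0 n0 (ltW gs)) P2.
have c0 : 0 <= 2 * n * (1 + u) * u by rewrite !mulr_ge0//; lra.
have h3 : 2 * n * (1 + u) * (K * (2 * (1 + u) + 4 * g * u + g ^+ 2 * u)) <=
    n * (K + 2 * g * s) * (4 * (1 + u) ^+ 2 - 4 * (1 + u) * (u * rho)).
  rewrite -subr_ge0; have := mulr_ge0 c0 q2; congr (0 <= _).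
  by rewrite /K /v /s; ring.
have e1 : N * (2 * (s + 1)) * (K + 2 * g * s) =
    2 * (N * (1 + (2 * (1 + g) - 1) * s) * K) by rewrite /K; ring.
have e2 : n * (1 + u) * (2 - u + 2 * (1 + g) * u + (1 + g) ^+ 2 * u) * K =
   n * (1 + u) * (K * (2 * (1 + u) + 4 * g * u + g ^+ 2 * u)) by ring.
rewrite e2 in h1; rewrite e1; move: h1 h2 h3 {e1 e2 hN}.
set X := N * _ * K; set Y := K * (_ + _); set Z := _ - 4 * (1 + u) * _.
by move=> h1 h2 h3; lra.
Qed.

Lemma le_fbound_of_trace N :
  (forall d, 0 <= d -> N * (1 + (2 * d - 1) * (n * u ^+ 2)) <=
     n * (1 + u) * (2 - u + 2 * d * u + d ^+ 2 * u)) ->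
  8 * u ^+ 2 * N <= (1 + u) * (17 * u + 1) -> N <= fbound.
Proof.
move=> HN Hc; have [x1|/ltW x1] := leP (n * u) (1 / 2).
  by apply: fbound_small => //; have := HN 0 (lexx 0); lra.
have [hs|/ltW hs] := leP (n * u ^+ 2) ((1 + 5 * u) / 4).
  exact: fbound_mid.
exact: fbound_large.
Qed.

(** The right-hand side of [fbound_le_limit] is [f] with [fnum] replaced by
    [g = 9 / 8 + 2 u] and [s = n u^2] infinite, so that the comparison reads
    [g + e <= g sqrt (1 + 1 / s)]; the hypothesis replaces the square root by
    its smaller Pade approximant [(4 s + 3) / (4 s + 1)]. *)
Lemma sqr_add_le_pade (e g s : F) : 0 <= e -> 0 <= g -> 0 <= s ->
  e * (4 * s + 1) <= 2 * g -> s * (g + e) ^+ 2 <= g ^+ 2 * (s + 1).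
Proof.
move=> e0 g0 s0 h.
have k0 : 0 < 4 * s + 1 by lra.
have q0 : 0 < (4 * s + 1) ^+ 2 by rewrite exprn_gt0.
rewrite -(ler_pM2r q0).
have h1 := ler_wpM2l (mulr_ge0 (mulr_ge0 s0 g0) (ltW k0)) h.
have h2 : (e * (4 * s + 1)) ^+ 2 <= (2 * g) ^+ 2.
  by rewrite lerXn2r// nnegrE mulr_ge0// ltW.
have h3 := ler_wpM2l s0 h2.
have := sqr_ge0 g.
lra.
Qed.

Lemma excess_poly_ge4 : 4 <= n ->
  excess * (4 * (n * u ^+ 2) + 1) <= 2 * (9/8 + 2 * u).
Proof.
move=> n4; have D := fden_gt0; have eE := excessE.
have m0 : 0 <= n - 4 by rewrite subr_ge0.
have := coef_cubic_ge0 u0 u1 m0; rewrite /coef0 /coef1 /coef2 /coef3 => h.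
have D2 : 0 < 2 * fden by lra.
rewrite -(ler_pM2r D2) mulrAC eE; move: h; rewrite /fden; lra.
Qed.

(** For [n = 3] the Pade approximant is too lossy near [u = 0.95]. *)
Lemma excess_poly_3 : n = 3 ->
  n * u ^+ 2 * (9/8 + 2 * u + excess) ^+ 2 <=
  (9/8 + 2 * u) ^+ 2 * (n * u ^+ 2 + 1).
Proof.
move=> n_3; have D := fden_gt0; have eE := excessE.
have D2 : 0 < (2 * fden) ^+ 2 by rewrite exprn_gt0//; lra.
rewrite -(ler_pM2r D2).
have -> : n * u ^+ 2 * (9/8 + 2 * u + excess) ^+ 2 * (2 * fden) ^+ 2 =
  n * u ^+ 2 * ((9/8 + 2 * u) * (2 * fden) + excess * (2 * fden)) ^+ 2 by ring.
rewrite eE /fden n_3; have [h|/ltW h] := leP u (4/5).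
  by bernstein F 9%N u0 h.
by bernstein F 9%N h u1.
Qed.

Lemma fbound_le_limit : n = 3 \/ 4 <= n -> 0 < u ->
  fbound <= (9 + 16 * u) ^+ 2 / (128 * u ^+ 2).
Proof.
move: n3 => hn3 hn u_gt0.
have uu : 0 < u ^+ 2 by rewrite exprn_gt0.
have s0 : 0 <= n * u ^+ 2 by rewrite mulr_ge0 ?(ltW uu)//; lra.
have H : n * u ^+ 2 * fnum ^+ 2 <= (9/8 + 2 * u) ^+ 2 * (n * u ^+ 2 + 1).
  rewrite fnumE; case: hn => [n_3|n4].
    exact: excess_poly_3.
  by apply: sqr_add_le_pade; rewrite ?excess_ge0 ?excess_poly_ge4//; lra.
rewrite /fbound ler_pdivrMr; last by lra.
rewrite [leRHS]mulrAC ler_pdivlMr; last by rewrite mulr_gt0//; lra.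
lra.
Qed.

End Bound.

(** * Cardinalities *)

Lemma pntE (R : realType) (n : nat) (t : R) : (3 <= n)%N -> t <= 0 ->
  pnt n t * (1 - t) = fnum n%:R (- t).
Proof.
move=> n3 t0; have n3R : (3 : R) <= n%:R by rewrite ler_nat.
have nt0 : 0 <= - t by lra.
have := fden_gt0 n3R nt0.
rewrite /pnt /fnum /rho /fden; cbv zeta; move: n%:R n3R => r r3 D.
by field; do ?[apply/andP; split]; apply: lt0r_neq0; lra.
Qed.

Lemma fntE (R : realType) (n : nat) (t : R) : (3 <= n)%N -> t <= 0 ->
  fnt n t = fbound n%:R (- t).
Proof.
move=> n3 t0; rewrite /fbound -pntE// /fnt; cbv zeta.
rewrite sqrrN [(pnt n t * (1 - t)) ^+ 2]exprMn.
by congr (_ / _); rewrite mulrAC.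
Qed.

Section Cardinality.
Local Open Scope classical_set_scope.
Local Open Scope card_scope.

Lemma card_le_inj (T : Type) (N : nat) (S : set T) : `I_N #<= S ->
  exists2 v : 'I_N -> T, injective v & forall i, S (v i).
Proof.
move=> /card_leP[f].
have mem_I (i : 'I_N) : nat_of_ord i \in `I_N by apply/mem_set => /=.
exists (fun i => set_val (f (SigSub (mem_I i)))).
  move=> i j /val_inj /inj H; apply/val_inj.
  by have := H (mem_set I) (mem_set I) => /(congr1 val).
by move=> i; apply: set_valP.
Qed.

(** A maximal [k] such that [`I_k] embeds in a member of the family is the
    cardinality of that member and a bound for all others: an infinite member
    would embed every [`I_k]. *)
Lemma max_card_exists (T : Type) (P : set T -> Prop) (b : nat) : P set0 ->
  (forall S k, P S -> `I_k #<= S -> (k <= b)%N) ->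
  exists a, (exists2 S, P S & S #= `I_a) /\ (forall S, P S -> S #<= `I_a).
Proof.
move=> P0 Pb.
pose Q k := `[< exists2 S, P S & `I_k #<= S >].
have Q0 : exists k, Q k by exists 0%N; apply/asboolP; exists set0; rewrite ?II0.
have Qb k : Q k -> (k <= b)%N by move=> /asboolP[S PS]; exact: Pb.
case: (ex_maxnP Q0 Qb) => a /asboolP[S0 PS0 aS0] amax.
have card S : P S -> exists2 m, S #= `I_m & (m <= a)%N.
  move=> PS; have [/finite_setP[m Sm]|infS] := pselect (finite_set S).
    exists m => //; apply: amax; apply/asboolP; exists S => //.
    by rewrite (card_le_eqr Sm).
  have /amax : Q a.+1.
    apply/asboolP; exists S => //; apply: card_le_trans (_ : [set: nat] #<= S).
      by apply/subset_card_le => x _.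
    exact/infiniteP.
  by rewrite ltnn.
exists a; split; last first.
  by move=> S /card[m Sm ma]; rewrite (card_le_eql Sm) card_le_II.
exists S0 => //; have [m Sm ma] := card _ PS0.
suff -> : a = m by [].
by apply/eqP; rewrite eqn_leq ma -card_le_II -(card_le_eqr Sm) aS0.
Qed.

Lemma almost_equiangular_size (R : realType) (n : nat) (t : R)
    (S : set 'cV[R]_n) (N : nat) :
  (3 <= n)%N -> -1 <= t <= 0 -> almost_equiangular t S -> `I_N #<= S ->
  N%:R <= fnt n t.
Proof.
move=> n3 /andP[t1 t0] [Ssphere Striple] /card_le_inj[v v_inj vS].
have n3R : (3 : R) <= n%:R by rewrite ler_nat.
have nt0 : 0 <= - t by lra.
have nt1 : - t <= 1 by lra.
rewrite fntE//; case: (posnP N) => [->|N0].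
  apply: divr_ge0; first by rewrite mulr_ge0 ?sqr_ge0.
  have : 0 <= n%:R * (- t) ^+ 2 by rewrite mulr_ge0 ?sqr_ge0.
  lra.
have n0 : (0 < n)%N by exact: leq_trans n3.
pose V : 'M[R]_(n, N) := \matrix_(a, i) v i a ord0.
have GE i j : (V^T *m V) i j = dotp (v i) (v j).
  by rewrite /dotp !mxE; apply: eq_bigr => a _; rewrite !mxE.
have G1 i : (V^T *m V) i i = 1 by rewrite GE; exact: Ssphere.
have Gt i j k : i != j -> i != k -> j != k ->
    t \in [:: (V^T *m V) i j; (V^T *m V) i k; (V^T *m V) j k].
  by move=> ij ik jk; rewrite !GE; apply: Striple; rewrite ?(inj_eq v_inj).
apply: le_fbound_of_trace => //.
  move=> d d0; have := size_le_convex G1 Gt erefl N0 n0 t0 d0.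
  by rewrite sqrrN !mulrN !opprK.
have := size_le_const G1 Gt erefl N0 n0 t0.
by rewrite sqrrN !mulrN [- _ + 1]addrC.
Qed.

End Cardinality.

Theorem theorem8p1 (R : realType) (n : nat) (t : R)
    (hn : (3 <= n)%N) (ht : -1 <= t <= 0) :
  exists a : nat,
    [/\ is_alpha n t a,
        a%:Z <= Num.floor (fnt n t)
      & t != 0 ->
        Num.floor (fnt n t)
          <= Num.floor ((16 * t - 9) ^+ 2 / (128 * t ^+ 2))].
Proof.
have [t1 t0] := andP ht.
have size S k (aeS : almost_equiangular t S) :=
  almost_equiangular_size (N := k) hn ht aeS.
have [||a [[S aeS Sa] amax]] :=
    @max_card_exists _ (@almost_equiangular R n t) `|Num.floor (fnt n t)|%N.
- by split=> [x []|x y z []].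
- move=> S k aeS /(size _ _ aeS) kf.
  by rewrite -lez_nat abszE; apply: le_trans (ler_norm _); rewrite floor_ge_int.
exists a; split; first by split=> //; exists S.
- by rewrite floor_ge_int; apply: (size S) => //; rewrite (card_le_eqr Sa).
- move=> tn0; apply: le_floor; rewrite fntE//.
  have n3R : (3 : R) <= n%:R by rewrite ler_nat.
  have nt0 : 0 < - t by rewrite oppr_gt0 lt_neqAle tn0.
  have n34 : n%:R = 3 :> R \/ 4 <= n%:R :> R.
    move: hn; rewrite leq_eqVlt => /orP[/eqP <-|n4]; first by left.
    by right; rewrite ler_nat.
  have -> : 16 * t - 9 = - (9 + 16 * - t) by ring.
  rewrite sqrrN -(sqrrN t).
  by apply: fbound_le_limit => //; [exact: ltW | lra].
Qed.
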